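(* Let $i\ge 3$ and, for $0\le j\le i-1$, let $\Theta_{i,j}$ be the set of starting positions of the occurrences of $F_{i-j}$ in $F_i$. Then $\Theta_{i,0}=\Theta_{i,1}=\{1\}$, and for every $j$ with $2\le j\le i-4$: (i) if $j$ is even, $\Theta_{i,j}=\Theta_{i,j-1}\cup(\Theta_{i,j-2}\oplus f_{i-j})\cup\{f_i-f_{i-j}+1\}$, the three sets in this union are mutually disjoint, and $\max(\Theta_{i,j})=f_i-f_{i-j}+1$; (ii) if $j$ is odd, $\Theta_{i,j}=\Theta_{i,j-1}\cup(\Theta_{i,j-2}\oplus f_{i-j})$, the two sets in this union are disjoint, and $\max(\Theta_{i,j})=f_i-f_{i-(j-1)}+1$.
   Context: Fibonacci words: $F_1=\texttt{b}$, $F_2=\texttt{a}$, $F_k=F_{k-1}F_{k-2}$ for $k\ge 3$; $f_k=|F_k|$. Positions are 1-indexed; $S$ occurs at position $p$ in $T$ if $T[p\ldots p+|S|-1]=S$. For a set of integers $A$ and an integer $c$, $A\oplus c:=\{a+c : a\in A\}$, and $\max(A)$ is its largest element. *)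

(* Defs.v *)
From HB Require Import structures.
From mathcomp Require Import all_boot finmap.

Set Implicit Arguments.
Unset Strict Implicit.
Unset Printing Implicit Defensive.

Local Open Scope fset_scope.
Local Open Scope nat_scope.

Inductive letter := La | Lb.

Definition letter_eqb (x y : letter) : bool :=
  match x, y with La, La | Lb, Lb => true | _, _ => false end.

Lemma letter_eqbP : Equality.axiom letter_eqb.
Proof. by do 2!case; constructor. Qed.

HB.instance Definition _ := hasDecEq.Build letter letter_eqbP.

(* The Fibonacci words are indexed from 1; the value at index 0 is junk. *)
Fixpoint fib_word (k : nat) : seq letter :=
  match k with
  | 0 => [::]
  | 1 => [:: Lb]
  | 2 => [:: La]
  | (m.+1 as k1).+1 => fib_word k1 ++ fib_word m
  end.

Definition fib_len (k : nat) : nat := size (fib_word k).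

(* T[p .. q], positions counted from 1 and both ends included; meant for
   1 <= p and q <= size T. *)
Definition factor (T : seq letter) (p q : nat) : seq letter :=
  drop p.-1 (take q T).

Definition occurs_at (S T : seq letter) (p : nat) : bool :=
  [&& 1 <= p, p + size S - 1 <= size T & factor T p (p + size S - 1) == S].

(* Every occurrence of a nonempty S in T starts in 1 .. size T, so the range
   of p loses nothing. *)
Definition occurrences (S T : seq letter) : {fset nat} :=
  [fset p in iota 1 (size T) | occurs_at S T p].

Definition Theta (i j : nat) : {fset nat} :=
  occurrences (fib_word (i - j)) (fib_word i).

Definition shift (A : {fset nat}) (c : nat) : {fset nat} :=
  [fset a + c | a in A].

(* The largest element of A when A is nonempty, and 0 when A is empty. *)
Definition fset_max (A : {fset nat}) : nat := \max_(a <- A) a.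

(* Main.v *)
(* F_i is a concatenation of blocks F_k and F_(k-1), read off from F_(i-k+2) by
   a -> F_k, b -> F_(k-1), and F_k occurs in F_i only at block boundaries:
   this follows by undoing the substitution a -> ab, b -> a one step at a time.
   A block F_k that is not the last one starts an occurrence of F_(k+1); a block
   F_(k-1) other than the last one sits between two blocks F_k, in the middle
   of an occurrence of F_(k+2); the last block F_k gives the extra position. *)
Require Import Defs.
From mathcomp Require Import all_boot finmap zify.

Local Open Scope fset_scope.
Local Open Scope nat_scope.

Local Arguments fib_word : simpl never.

(** * Fibonacci words: lengths, borders, last letters *)

Lemma fib_wordSS n : fib_word n.+3 = fib_word n.+2 ++ fib_word n.+1.
Proof. by []. Qed.

Lemma fib_lenSS n : fib_len n.+3 = fib_len n.+2 + fib_len n.+1.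
Proof. by rewrite /fib_len fib_wordSS size_cat. Qed.

Lemma fib_len_gt0 n : 0 < fib_len n.+1.
Proof. by elim: n => [|[|n] IH] //; rewrite fib_lenSS addn_gt0 IH. Qed.

Lemma fib_word_prefix n : prefix (fib_word n.+2) (fib_word n.+3).
Proof. exact: prefix_prefix. Qed.

(** Each $F_k$ ends in $F_{k-2}$, so the induction moves the index by two. *)
Lemma fib_word_suffix n m : ~~ odd m -> suffix (fib_word n.+1) (fib_word (m + n.+1)).
Proof.
move=> em; rewrite -[m]odd_double_half (negbTE em) add0n.
elim: m./2 => [|h IH]; first exact: suffix_refl.
rewrite doubleS !addSn addnS fib_wordSS -addnS.
exact: suffix_trans IH (suffix_suffix _ _).
Qed.

(** Cancelling the common prefix $F_{n+2}$ turns each case into the previous one with its sides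
    swapped. *)
Lemma fib_word_noncomm n :
  fib_word n.+2 ++ fib_word n.+1 != fib_word n.+1 ++ fib_word n.+2.
Proof.
by elim: n => // n IH; rewrite [fib_word n.+3]fib_wordSS -catA eqseq_cat ?eqxx//=
  eq_sym.
Qed.

Lemma last_fib_word x n : last x (fib_word n.+1) = if odd n then La else Lb.
Proof.
elim/ltn_ind: n x => -[|[|n]] IH x //.
by rewrite fib_wordSS last_cat IH //= negbK.
Qed.

(** * Block substitutions and their inversion *)

Definition block (n : nat) (x : letter) : seq letter :=
  if x is La then fib_word n.+1 else fib_word n.

(* The substitution a -> F_(n+1), b -> F_n; for n = 2 it is a -> ab, b -> a. *)
Definition blocks (n : nat) (T : seq letter) : seq letter :=
  flatten (map (block n) T).

Lemma blocks_La n T : blocks n (La :: T) = fib_word n.+1 ++ blocks n T.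
Proof. by []. Qed.

Lemma blocks_Lb n T : blocks n (Lb :: T) = fib_word n ++ blocks n T.
Proof. by []. Qed.

Lemma blocks_cat n S T : blocks n (S ++ T) = blocks n S ++ blocks n T.
Proof. by rewrite /blocks map_cat flatten_cat. Qed.

Lemma blocks_fib_word n m :
  blocks n.+1 (fib_word m.+1) = fib_word (m + n.+1).
Proof.
elim/ltn_ind: m => -[|[|m]] IH; try exact: cats0.
by rewrite fib_wordSS blocks_cat !IH // !addnS.
Qed.

(** This peels one step a -> ab, b -> a off a block decomposition and drives the induction on the
    block size. *)
Lemma blocks2_blocks n T : blocks 2 (blocks n.+1 T) = blocks n.+2 T.
Proof.
elim: T => //= x T IH; rewrite /blocks /= -!/(blocks _ _) blocks_cat IH.
by congr cat; case: x; rewrite /block blocks_fib_word ?addn2 // addn2.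
Qed.

Lemma blocks2_headP T : blocks 2 T = [::] \/ exists S, blocks 2 T = La :: S.
Proof. by case: T => [|[] T]; [left | right; eexists | right; eexists]. Qed.

(** The images ab and a contain the letter a only at their start. *)
Lemma blocks2_boundary T d :
    prefix [:: La] (drop d (blocks 2 T)) ->
  exists T1 T2, T = T1 ++ T2 /\ d = size (blocks 2 T1).
Proof.
elim: T d => [|x T IH] [|d] //.
- by move=> _; exists [::], (x :: T).
case: x; rewrite /= -/(blocks _ _).
- case: d => [//|d] /= /IH [T1 [T2 [-> ->]]].
  by exists (La :: T1), T2.
- by move=> /IH [T1 [T2 [-> ->]]]; exists (Lb :: T1), T2.
Qed.

Definition flip (x : letter) := if x is La then Lb else La.

(** The letter after an a tells which image that a starts: ab comes from a, while aa shows that the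
    first a is the image of b. *)
Lemma blocks2_prefix_inv V x U :
    prefix (blocks 2 V ++ [:: La; x]) (blocks 2 U) ->
  prefix (rcons V (flip x)) U.
Proof.
elim: V U => [|[] V IH] [|[] U]; rewrite ?prefixs0 //= -?/(blocks _ _).
- by rewrite !prefix0s; case: x.
- by rewrite !prefix0s; case: x => //; case: (blocks2_headP U) => [->|[S ->]].
- by move=> /IH.
- by case: (blocks2_headP U) => [->|[S ->]].
- by case: (blocks2_headP V) => [->|[S ->]].
- by move=> /IH.
Qed.

(** The central words: $F_{n+3}$ without its last two letters. The images aba of ab and aab of ba
    share their first a, which joins the center and leaves the final pair swapped. *)
Fixpoint center (n : nat) : seq letter :=
  if n is m.+1 then rcons (blocks 2 (center m)) La else [::].

Definition penult (n : nat) : letter := if odd n then Lb else La.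

Lemma flip_penult n : flip (penult n.+1) = penult n.
Proof. by rewrite /penult /=; case: odd. Qed.

Lemma fib_word_center n :
  fib_word n.+3 = center n ++ [:: penult n; flip (penult n)].
Proof.
elim: n => // n IH.
have -> : fib_word n.+4 = blocks 2 (fib_word n.+3) by rewrite blocks_fib_word addn2.
rewrite IH blocks_cat cat_rcons; congr cat.
by rewrite /penult /=; case: odd.
Qed.

(* The hypothesis omits the last letter of F_(n+3): when that letter is b, its
   image a may also be the start of ab, so it cannot be recovered by undoing
   the substitution, whereas the letter before it can. *)
Lemma center_boundary n T d :
    prefix (rcons (center n) (penult n)) (drop d (blocks n.+2 T)) ->
  exists T1 T2, T = T1 ++ T2 /\ d = size (blocks n.+2 T1).
Proof.
elim: n T d => [|n IH] T d; first exact: blocks2_boundary.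
rewrite -blocks2_blocks -cats1 /= cat_rcons => pre.
have preA : prefix [:: La] (drop d (blocks 2 (blocks n.+2 T))).
  apply: prefix_trans pre.
  by case: (blocks2_headP (center n)) => [->|[S ->]] /=; rewrite ?prefix0s.
have [U1 [U2 [eU dE]]] := blocks2_boundary _ _ preA.
move: pre; rewrite dE eU blocks_cat drop_size_cat // => /blocks2_prefix_inv.
rewrite flip_penult => pre.
have [|T1 [T2 [eT sz]]] := IH T (size U1); first by rewrite eU drop_size_cat.
exists T1, T2; split=> //; rewrite -(blocks2_blocks n.+1); congr (size (blocks 2 _)).
(* [U1] and [blocks n.+2 T1] are prefixes of one word and have the same length, so they are
   equal. *)
by move/(congr1 (take (size U1))): eU; rewrite eT blocks_cat take_size_cat // sz
  take_size_cat.
Qed.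

Lemma fib_word_boundary n T d :
    prefix (fib_word n.+3) (drop d (blocks n.+2 T)) ->
  exists T1 T2, T = T1 ++ T2 /\ d = size (blocks n.+2 T1).
Proof.
move=> pre; apply: center_boundary; apply: prefix_trans pre.
by rewrite fib_word_center -cat_rcons prefix_prefix.
Qed.

(** A b occurs only as the second letter of an image ab, and the next image starts with a. *)
Lemma blocks2_isolated_b U T1 T2 :
    blocks 2 U = T1 ++ Lb :: T2 ->
  (exists S, T1 = rcons S La) /\ (T2 = [::] \/ exists S, T2 = La :: S).
Proof.
elim: U T1 => [|[] U IH] [|y T1] //=; rewrite -/(blocks _ _) => -[<-].
- case: T1 => [[<-]|z T1 [_ /IH [[S ->] hT2]]].
  + by split; [exists [::] | exact: blocks2_headP].
  + by split=> //; exists [:: La, z & S].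
- by move=> /IH [[S ->] hT2]; split=> //; exists (La :: S).
Qed.

Lemma fib_word_isolated_b n T1 T2 :
    fib_word n.+2 = T1 ++ Lb :: T2 ->
  (exists S, T1 = rcons S La) /\ (T2 = [::] \/ exists S, T2 = La :: S).
Proof.
rewrite -addn2 -blocks_fib_word; exact: blocks2_isolated_b.
Qed.

(** * Position sets and their maxima *)

Lemma prefix_size_drop {S T : seq letter} {d} :
  0 < size S -> prefix S (drop d T) -> d + size S <= size T.
Proof.
move=> S0 /size_prefix; rewrite size_drop; move: S0.
by move: (size S) (size T); lia.
Qed.

Lemma mem_Theta i j p : j < i ->
  (p \in Theta i j) = (0 < p) && prefix (fib_word (i - j)) (drop p.-1 (fib_word i)).
Proof.
move=> ji; have S0 : 0 < size (fib_word (i - j)).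
  by have -> : i - j = (i - j).-1.+1 by [lia]; apply: fib_len_gt0.
rewrite !inE mem_iota /occurs_at /factor; case: p => [|p] //=.
set S := fib_word _ in S0 *; set T := fib_word i.
have -> : p.+1 + size S - 1 = size S + p by lia.
rewrite -take_drop -prefixE; case pre: (prefix _ _); last by rewrite !andbF.
by have := prefix_size_drop S0 pre; lia.
Qed.

Lemma mem_shift (A : {fset nat}) c q :
  reflect (exists2 p, p \in A & q = p + c) (q \in shift A c).
Proof.
by rewrite /shift; apply: (iffP (imfsetP _ _ _ _)) => -[p]; exists p.
Qed.

Lemma fset_maxP (A : {fset nat}) m :
  m \in A -> (forall a, a \in A -> a <= m) -> fset_max A = m.
Proof.
move=> mA ub; apply/eqP; rewrite eqn_leq; apply/andP; split.
- by apply/bigmax_leqP_seq => a aA _; apply: ub.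
- exact: (leq_bigmax_seq (F := id)).
Qed.

(** * Classification of the occurrences *)

Lemma fib_word_occ_cases n m d :
    prefix (fib_word n.+4) (drop d (fib_word (m.+2 + n.+4))) ->
  [\/ prefix (fib_word n.+1.+4) (drop d (fib_word (m.+2 + n.+4))),
      exists2 e, d = e + fib_len n.+4 &
        prefix (fib_word n.+2.+4) (drop e (fib_word (m.+2 + n.+4)))
    | ~~ odd m /\ d = fib_len (m.+2 + n.+4) - fib_len n.+4].
Proof.
have -> : fib_word (m.+2 + n.+4) = blocks n.+3 (fib_word m.+4).
  by rewrite blocks_fib_word -addSnnS.
have -> : fib_len (m.+2 + n.+4) = size (blocks n.+3 (fib_word m.+4)).
  by rewrite blocks_fib_word -addSnnS.
move=> pre; have [T1 [T2 [eT dE]]] := fib_word_boundary _ _ _ pre.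
move: pre; rewrite eT dE blocks_cat drop_size_cat //.
case: T2 eT => [|[] T2] eT.
- by move/size_prefix/(leq_trans (fib_len_gt0 _)).
- case: T2 eT => [|y T2] eT _.
  + apply: Or33; split; last by rewrite size_cat blocks_La cats0 addnK.
    (* The outer word $F_{m+4}$ ends in a exactly when [m] is even. *)
    have := last_fib_word Lb m.+3; rewrite eT last_cat /=.
    by case: (odd m).
  + apply: Or31; rewrite blocks_La [fib_word n.+1.+4]fib_wordSS prefix_catr // eqxx /=.
    (* Whichever block follows, it starts with $F_{n+3}$, which completes $F_{n+5}$. *)
    case: y {eT}; last by rewrite blocks_Lb prefix_prefix.
    by rewrite blocks_La fib_wordSS -catA prefix_prefix.
- have [[S eT1] hT2] := fib_word_isolated_b _ _ _ eT.
  case: hT2 eT => [->|[{}T2 ->]] eT.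
  (* A final block $F_{n+3}$ is too short to hold $F_{n+4}$. *)
  + move/size_prefix; rewrite blocks_Lb cats0 -!/(fib_len _) fib_lenSS.
    by have := fib_len_gt0 n.+1; lia.
  (* The witness is the start of the preceding block, since $F_{n+6}=F_{n+4}F_{n+3}F_{n+4}$. *)
  + move=> _; apply: Or32; exists (size (blocks n.+3 S)).
    * by rewrite eT1 -cats1 blocks_cat size_cat blocks_La cats0.
    * rewrite eT1 -cats1 blocks_cat -catA drop_size_cat //.
      rewrite blocks_La blocks_Lb blocks_La cats0.
      by rewrite [fib_word n.+2.+4]fib_wordSS [fib_word n.+1.+4]fib_wordSS
        !catA prefix_prefix.
Qed.

Lemma prefix_drop_cat (A B T : seq letter) d :
  prefix (A ++ B) (drop d T) -> prefix B (drop (d + size A) T).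
Proof.
rewrite addnC -drop_drop => /prefixP [R ->].
by rewrite -catA drop_size_cat // prefix_prefix.
Qed.

Lemma fib_word_mid n T d :
    prefix (fib_word n.+2.+4) (drop d T) ->
  prefix (fib_word n.+3 ++ fib_word n.+4) (drop (d + fib_len n.+4) T).
Proof.
rewrite [fib_word n.+2.+4]fib_wordSS [fib_word n.+1.+4]fib_wordSS -catA.
exact: prefix_drop_cat.
Qed.

Lemma fib_word_mid_occ n T d :
    prefix (fib_word n.+2.+4) (drop d T) ->
  prefix (fib_word n.+4) (drop (d + fib_len n.+4) T).
Proof.
move/fib_word_mid; apply: prefix_trans.
by rewrite [fib_word n.+4]fib_wordSS prefix_catr // eqxx fib_wordSS -catA prefix_prefix.
Qed.

(** The text there reads $F_{n+3}F_{n+4}$, which has the length of $F_{n+5}=F_{n+4}F_{n+3}$ but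
    differs from it. This is what makes the first two sets of the union disjoint. *)
Lemma fib_word_mid_notocc n T d :
    prefix (fib_word n.+2.+4) (drop d T) ->
  ~~ prefix (fib_word n.+1.+4) (drop (d + fib_len n.+4) T).
Proof.
move/fib_word_mid; rewrite !prefixE => /eqP mid; apply/negP => /eqP.
rewrite fib_wordSS size_cat addnC -size_cat mid => /esym/eqP.
exact/negP/fib_word_noncomm.
Qed.

Lemma fib_word_last_occ n m : ~~ odd m ->
  prefix (fib_word n.+1)
    (drop (fib_len (m + n.+1) - fib_len n.+1) (fib_word (m + n.+1))).
Proof.
move/(fib_word_suffix n)/suffixP => [R eR].
by rewrite /fib_len eR size_cat addnK drop_size_cat // prefix_refl.
Qed.

(** * The sets of starting positions *)

Lemma Theta_max_even i j : j < i -> ~~ odd j ->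
  fset_max (Theta i j) = fib_len i - fib_len (i - j) + 1.
Proof.
move=> ji ej; have [n eij] : exists n, i - j = n.+1 by exists (i - j).-1; lia.
have ei : i = j + n.+1 by lia.
apply: fset_maxP => [|a]; rewrite mem_Theta // addn1 eij.
- by rewrite ei fib_word_last_occ.
- case/andP=> a0 /(prefix_size_drop (fib_len_gt0 n)); rewrite -!/(fib_len _).
  by lia.
Qed.

Lemma Theta1 i : 3 <= i -> Theta i 0 = [fset 1] /\ Theta i 1 = [fset 1].
Proof.
case: i => [|[|[|i]]] // _; split; apply/fsetP => -[|p];
  rewrite mem_Theta // ?subn0 ?subSS ?subn0 inE //=.
- case: p => [|p]; first by rewrite drop0 prefix_refl.
  by apply/negP => /(prefix_size_drop (fib_len_gt0 i.+2)); lia.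
- case: p => [|p]; first by rewrite drop0 fib_word_prefix.
  apply/negP; case: i => [|i] pre.
    by move: pre; case: p => [|[]].
  have := prefix_size_drop (fib_len_gt0 i.+2) pre; rewrite -!/(fib_len _).
  (* A nonzero block boundary lies after the first block, where too few letters remain for
     $F_{i+3}$. *)
  move: pre; have -> : fib_word i.+4 = blocks i.+2 [:: La; Lb].
    by rewrite (blocks_fib_word i.+1 2).
  case/fib_word_boundary => -[|y T1] [T2 [//]] -[<- _] ->.
  rewrite blocks_La size_cat -!/(fib_len _) [fib_len i.+4]fib_lenSS.
  rewrite [fib_len i.+3]fib_lenSS; have := fib_len_gt0 i; lia.
Qed.

Lemma Theta_cases n m p :
  (p \in Theta (m.+2 + n.+4) m.+2) =
  [|| p \in Theta (m.+2 + n.+4) m.+1,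
      p \in shift (Theta (m.+2 + n.+4) m) (fib_len n.+4)
    | ~~ odd m && (p == fib_len (m.+2 + n.+4) - fib_len n.+4 + 1)].
Proof.
have ek : m.+2 + n.+4 - m.+2 = n.+4 by lia.
have ek1 : m.+2 + n.+4 - m.+1 = n.+1.+4 by lia.
have ek2 : m.+2 + n.+4 - m = n.+2.+4 by lia.
apply/idP/or3P.
- rewrite mem_Theta ?ek; last by lia.
  case: p => // p /= /fib_word_occ_cases [pre | [e -> pre] | [em ->]].
  + by apply: Or31; rewrite mem_Theta ?ek1 //; lia.
  + apply: Or32; apply/mem_shift; exists e.+1 => //.
    by rewrite mem_Theta ?ek2 //; lia.
  + by apply: Or33; rewrite em addn1 eqxx.
- case=> [|/mem_shift [q hq ->]|/andP [em /eqP ->]]; last first.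
  + by rewrite mem_Theta ?ek ?addn1 ?fib_word_last_occ //= ?negbK //; lia.
  + move: hq; rewrite !mem_Theta ?ek ?ek2; try by lia.
    by case: q => // q /= /fib_word_mid_occ.
  + rewrite !mem_Theta ?ek ?ek1; try by lia.
    by case/andP=> -> /(prefix_trans (fib_word_prefix _)).
Qed.

Lemma Theta_shift_disjoint n m :
  [disjoint Theta (m.+2 + n.+4) m.+1 & shift (Theta (m.+2 + n.+4) m) (fib_len n.+4)].
Proof.
have ek1 : m.+2 + n.+4 - m.+1 = n.+1.+4 by lia.
have ek2 : m.+2 + n.+4 - m = n.+2.+4 by lia.
apply/fdisjointP => p h1; apply/negP => /mem_shift [q h2 ep].
move: h1 h2; rewrite ep !mem_Theta ?ek1 ?ek2; try by lia.
case: q {ep} => // q; rewrite addSn /= => h1 /fib_word_mid_notocc.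
by rewrite h1.
Qed.

(** Longer words must start further left; this keeps the other two sets away from the extra position
    and bounds the maximum for odd [j]. *)
Lemma Theta_le n m j p : j <= m ->
  p \in Theta (m + n.+1) j -> p + fib_len (m + n.+1 - j) <= fib_len (m + n.+1) + 1.
Proof.
move=> jm; rewrite mem_Theta; last by lia.
have -> : m + n.+1 - j = (m - j + n).+1 by lia.
case: p => // p /(prefix_size_drop (fib_len_gt0 _)).
by rewrite -!/(fib_len _) /=; lia.
Qed.

Theorem theorem16 (i : nat) (hi : 3 <= i) :
  (Theta i 0 = [fset 1] /\ Theta i 1 = [fset 1]) /\
  (forall j : nat, 2 <= j -> j + 4 <= i ->
    (~~ odd j ->
       Theta i j = Theta i (j - 1)
                     `|` shift (Theta i (j - 2)) (fib_len (i - j))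
                     `|` [fset fib_len i - fib_len (i - j) + 1] /\
       [disjoint Theta i (j - 1) & shift (Theta i (j - 2)) (fib_len (i - j))] /\
       [disjoint Theta i (j - 1) & [fset fib_len i - fib_len (i - j) + 1]] /\
       [disjoint shift (Theta i (j - 2)) (fib_len (i - j))
               & [fset fib_len i - fib_len (i - j) + 1]] /\
       fset_max (Theta i j) = fib_len i - fib_len (i - j) + 1) /\
    (odd j ->
       Theta i j = Theta i (j - 1)
                     `|` shift (Theta i (j - 2)) (fib_len (i - j)) /\
       [disjoint Theta i (j - 1) & shift (Theta i (j - 2)) (fib_len (i - j))] /\
       fset_max (Theta i j) = fib_len i - fib_len (i - (j - 1)) + 1)).
Proof.
split=> [|j j2 j4i]; first exact: Theta1.
have [n [m [-> ->]]] : exists n m, i = m.+2 + n.+4 /\ j = m.+2.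
  by exists (i - j - 4), (j - 2); lia.
rewrite addKn !oddS !negbK.
have -> : m.+2 - 1 = m.+1 by lia.
have -> : m.+2 - 2 = m by lia.
have Hdisj := Theta_shift_disjoint n m.
(* By [Hlen], shifting the bound [le2] by [fib_len n.+4] yields the bound of [le1]; by [Hlen1] that
   bound is strictly below the extra position. *)
have Hlen : fib_len n.+2.+4 = fib_len n.+4 + fib_len n.+1.+4.
  by rewrite fib_lenSS addnC.
have Hlen1 : fib_len n.+4 < fib_len n.+1.+4.
  by rewrite [fib_len n.+1.+4]fib_lenSS -addn1 leq_add2l fib_len_gt0.
have le1 p : p \in Theta (m.+2 + n.+4) m.+1 ->
    p + fib_len n.+1.+4 <= fib_len (m.+2 + n.+4) + 1.
  have -> : n.+1.+4 = m.+2 + n.+4 - m.+1 by lia.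
  by apply: Theta_le; lia.
have le2 p : p \in Theta (m.+2 + n.+4) m ->
    p + fib_len n.+2.+4 <= fib_len (m.+2 + n.+4) + 1.
  have -> : n.+2.+4 = m.+2 + n.+4 - m by lia.
  by apply: Theta_le; lia.
split=> [em|om].
- split; first by apply/fsetP => p; rewrite Theta_cases em !inE orbA.
  split=> //; split; [|split].
  + by apply/fdisjointP => p /le1; rewrite inE; lia.
  + apply/fdisjointP => p /mem_shift [q /le2 hq ->]; rewrite inE.
    by lia.
  + by rewrite Theta_max_even ?addKn ?oddS ?negbK //; lia.
- have ek1 : m.+2 + n.+4 - m.+1 = n.+1.+4 by lia.
  split; first by apply/fsetP => p; rewrite Theta_cases om !inE orbF.
  split=> //; rewrite ek1.
  apply: fset_maxP => [|p]; rewrite Theta_cases.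
  + rewrite mem_Theta ?ek1 ?addn1 /=; last by lia.
    (* Here [m.+1] is even, so $F_{n+5}$ is a suffix of $F_i$ and attains the bound. *)
    have -> : m.+2 + n.+4 = m.+1 + n.+1.+4 by lia.
    by rewrite fib_word_last_occ //= negbK.
  + case/or3P => [/le1|/mem_shift [q /le2 hq ->]|/andP []]; try by lia.
Qed.
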